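(* Let $n\ge 2$ be an integer. There exists a constant $c_0>0$ (depending only on $n$) such that for every real $c_3\ge c_0$ there exist constants $c_4>0$ and $Q_0>0$ with the following property: for every integer $Q>Q_0$, every interval $I\subset\left[-\tfrac12,\tfrac12\right]$ of length $|I|=c_3\,Q^{-1}$ contains at least $c_4\,Q^{n}|I|$ real algebraic integers $\alpha$ of degree $\deg\alpha=n$ and height $H(\alpha)\le Q$.
   Context: For a polynomial $P(t)=a_nt^n+\ldots+a_1t+a_0$ with integer coefficients, its height is $H(P)=\max_{0\le j\le n}|a_j|$. An algebraic integer $\alpha$ of degree $n$ is a root of a monic polynomial $P(t)=t^n+a_{n-1}t^{n-1}+\ldots+a_1t+a_0$ with integer coefficients that is irreducible over $\mathbb{Q}$; its height is $H(\alpha)=H(P)$ (the leading coefficient $1$ is included in the maximum). $|I|$ denotes the length of a real interval $I$. The constants $c_0,c_3,c_4,Q_0$ do not depend on $Q$ or on the position of $I$. *)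

(* Defs.v *)
From mathcomp Require Import all_boot all_order all_algebra.
From mathcomp Require Import all_classical all_reals all_analysis.

Set Implicit Arguments.
Unset Strict Implicit.
Unset Printing Implicit Defensive.

Import Order.TTheory GRing.Theory Num.Theory.

Local Open Scope ring_scope.

Definition poly_height (P : {poly int}) : nat :=
  (\max_(i < size P) `|(P`_i)%R|)%N.

(* Such a P is unique when it exists; a is an algebraic integer exactly when
   there is one, and its degree and height are those of P. *)
Definition is_integral_minpoly (R : realType) (P : {poly int}) (a : R) : Prop :=
  [/\ P \is monic,
      irreducible_poly (map_poly intr P : {poly rat}) &
      root (map_poly intr P) a].

(* deg a = n and H(a) <= Q; recall that size P is the degree of P plus one. *)
Definition algint_degree_height_le (R : realType) (n : nat) (Q : int) (a : R) :
    Prop :=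
  exists P : {poly int},
    [/\ is_integral_minpoly P a, size P = n.+1 & (poly_height P)%:Z <= Q].

(* Main.v *)
Require Import Defs.
From mathcomp Require Import all_boot all_order all_algebra.
From mathcomp Require Import all_classical all_reals all_analysis.
From mathcomp Require Import zify ring lra.

(** It suffices to exhibit a constant times Q^(n-1) suitable numbers, since
    Q^n |I| = c3 Q^(n-1). Let M be about Q / (16 n) and N = n M. Consider the
    monic polynomials of degree n whose coefficients of degrees 1, ..., n - 1
    are 2 b_1 + 8 N, 2 b_2, ..., 2 b_(n-1) with 0 <= b_i < M: there are M^(n-1)
    choices of b. On [-1/2, 1/2] the linear term dominates, so such a polynomial
    is increasing there with slope at least 6 N, which is comparable to Q,
    whatever its constant coefficient. Over the middle half of I, of length
    c3 / (2 Q), its values therefore sweep an interval of length at least 4 as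
    soon as c3 is a large enough absolute constant, and the constant coefficient
    can be chosen congruent to 2 modulo 4 so that a root falls in I
    ([dominant_linear_coef_root]).

    The parity conditions are the point of the construction: all nonleading
    coefficients are even and the constant one is not divisible by 4, so
    Eisenstein's criterion at 2 gives irreducibility for every choice of b
    ([poly_cons_coef_irreducible]). The polynomials are thus the minimal
    polynomials of the chosen roots, and different b give different roots
    ([is_integral_minpoly_inj], [many_roots]). *)

Import Order.TTheory GRing.Theory Num.Theory.

Local Open Scope classical_set_scope.
Local Open Scope ring_scope.

(** On [-1/2, 1/2] the derivative of the (i+1)-st power is bounded by
    (i+1) / 2^i <= 1; induction on the exponent avoids derivatives. *)
Lemma ler_norm_subX (R : realFieldType) (x y : R) (i : nat) :
  `|x| <= 1 / 2 -> `|y| <= 1 / 2 -> `|y ^+ i.+1 - x ^+ i.+1| <= `|y - x|.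
Proof.
move=> hx hy; elim: i => [|i IHi]; first by rewrite !expr1.
have xi : `|x ^+ i.+1| <= 1 / 2.
  rewrite exprSr normrM -[leRHS]mul1r ler_pM// normrX exprn_ile1//.
  by apply: le_trans hx _; lra.
have -> : y ^+ i.+2 - x ^+ i.+2 =
    y * (y ^+ i.+1 - x ^+ i.+1) + (y - x) * x ^+ i.+1.
  by rewrite [y ^+ i.+2]exprS [x ^+ i.+2]exprS; ring.
rewrite (le_trans (ler_normD _ _))// !normrM.
have h1 : `|y| * `|y ^+ i.+1 - x ^+ i.+1| <= 1 / 2 * `|y - x| by rewrite ler_pM.
have h2 : `|y - x| * `|x ^+ i.+1| <= `|y - x| * (1 / 2) by rewrite ler_wpM2l.
by lra.
Qed.

(** The nonlinear terms perturb the slope [d 0] of the linear term by at most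
    the sum of their absolute coefficients: this is what makes a dominant linear
    coefficient force monotonicity, with an explicit slope. *)
Lemma horner_increment_near_linear (R : realFieldType) (m : nat)
    (d : nat -> R) (x y : R) :
  `|x| <= 1 / 2 -> `|y| <= 1 / 2 ->
  `|\sum_(i < m.+1) d i * y ^+ i.+1 - \sum_(i < m.+1) d i * x ^+ i.+1
      - d 0%N * (y - x)| <= (\sum_(i < m) `|d i.+1|) * `|y - x|.
Proof.
move=> hx hy; rewrite -sumrB big_ord_recl /= !expr1 -mulrBr addrAC subrr add0r.
rewrite mulr_suml (le_trans (ler_norm_sum _ _ _))// ler_sum// => i _.
by rewrite -mulrBr normrM ler_wpM2l// ler_norm_subX.
Qed.

Lemma exists_2mod4 (R : realType) (u v : R) :
  u + 4 <= v -> exists k : int, u <= (4 * k + 2)%:~R <= v.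
Proof.
move=> uv; exists (Num.ceil ((u - 2) / 4)).
have /andP[] := ceil_itv ((u - 2) / 4).
rewrite !(intrD, intrM) /=; set c : R := (Num.ceil _)%:~R => h1 h2.
by apply/andP; split; lra.
Qed.

(** Two irreducible polynomials with a common real root are not coprime over
    the rationals, hence associate to their gcd, hence equal when monic. *)
Lemma is_integral_minpoly_inj (R : realType) (P Q : {poly int}) (a : R) :
  is_integral_minpoly P a -> is_integral_minpoly Q a -> P = Q.
Proof.
move=> [monP [szP irrP] rP] [monQ [szQ irrQ] rQ].
pose f := map_poly (intr : int -> rat).
have fE (p : {poly int}) : map_poly (ratr : rat -> R) (f p) = map_poly intr p.
  by rewrite -map_poly_comp; apply: eq_map_poly => z /=; rewrite ratr_int.
have ncop : ~~ coprimep (f P) (f Q).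
  apply: contraL rQ; rewrite -(coprimep_map (ratr : rat -> R)) !fE.
  by move=> /coprimep_root /(_ rP).
have gP := irrP _ ncop (dvdp_gcdl _ _).
have gQ := irrQ _ ncop (dvdp_gcdr _ _).
have : f P %= f Q by rewrite (eqp_trans _ gQ)// eqp_sym.
rewrite eqp_monic ?monic_map// => /eqP.
by apply: (map_inj_poly (@intr_inj rat)).
Qed.

(** Passing to the closed middle half removes all case distinctions on whether
    the endpoints belong to the interval, at the cost of a factor 2. *)
Lemma itv_contains_middle_half (R : realType) (I : interval R) (L : R) :
  0 < L -> lebesgue_measure [set` I] = L%:E ->
  exists x y : R, y - x = L / 2 /\ (forall t : R, x <= t <= y -> t \in I).
Proof.
move=> L0; rewrite lebesgue_measure_itv.
case: ifP => [|_ [] L0']; last by move: L0; rewrite -L0' ltxx.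
case: I => [[bl u|[]] [br v|[]]] //= _ [Luv].
exists (u + L / 4), (v - L / 4); split; first by lra.
move=> t /andP[ht1 ht2]; rewrite itv_boundlr /=.
by case: bl Luv; case: br => Luv; rewrite ?bnd_simp; apply/andP; split; lra.
Qed.

(** The coefficients of positive degree are shifted by one ([d j] goes with
    degree [j.+1]) because the constant coefficient is chosen last, as a
    function of the others. *)
Definition poly_cons_coef (m : nat) (a : int) (d : nat -> nat) : {poly int} :=
  \poly_(i < m.+2) (if i is j.+1 then (d j)%:Z else a).

Lemma size_poly_cons_coef (m : nat) (a : int) (d : nat -> nat) :
  d m = 1%N -> size (poly_cons_coef m a d) = m.+2.
Proof. by move=> d_lead; rewrite size_poly_eq //= d_lead. Qed.

Lemma poly_cons_coef_monic (m : nat) (a : int) (d : nat -> nat) :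
  d m = 1%N -> poly_cons_coef m a d \is monic.
Proof. by move=> d_lead; rewrite monicE lead_coef_poly //= d_lead. Qed.

Lemma horner_poly_cons_coef (m : nat) (a : int) (d : nat -> nat)
    (R : realType) (t : R) :
  d m = 1%N ->
  (map_poly intr (poly_cons_coef m a d)).[t] =
    a%:~R + \sum_(i < m.+1) (d i)%:R * t ^+ i.+1.
Proof.
move=> d_lead; rewrite (horner_coef_wide _ (n := m.+2)); last first.
  by rewrite (leq_trans (size_poly _ _))// size_poly_cons_coef.
rewrite big_ord_recl /= coef_map coef_poly /= expr0 mulr1; congr (_ + _).
by apply: eq_bigr => i _; rewrite coef_map coef_poly /= ltnS ltn_ord.
Qed.

(** Eisenstein's criterion at 2: the constant coefficient is even but not
    divisible by 4. *)
Lemma poly_cons_coef_irreducible (m : nat) (a : int) (d : nat -> nat)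
    (k : int) :
  d m = 1%N -> a = 4 * k + 2 ->
  (forall i, (i < m)%N -> ~~ odd (d i)) ->
  irreducible_poly (map_poly intr (poly_cons_coef m a d) : {poly rat}).
Proof.
move=> d_lead ak d_even; apply/irreducible_rat_int.
apply: (@eisenstein_crit 2) => //.
- by rewrite size_poly_cons_coef.
- by rewrite lead_coef_poly //= d_lead.
- by rewrite coef_poly /= ak; lia.
move=> [|i]; rewrite size_poly_cons_coef//= coef_poly /= => hi; first by lia.
by rewrite ifT; [have := d_even i hi; lia | lia].
Qed.

Lemma poly_height_poly_cons_coef (m : nat) (a : int) (d : nat -> nat)
    (H : nat) :
  d m = 1%N -> (`|a| <= H)%N ->
  (forall i, (i <= m)%N -> (d i <= H)%N) ->
  (poly_height (poly_cons_coef m a d) <= H)%N.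
Proof.
move=> d_lead aH dH; apply/bigmax_leqP => -[[|i] /= + _];
  rewrite size_poly_cons_coef// coef_poly /= => hi; first by [].
by rewrite hi /= dH.
Qed.

(** The linear coefficient, at least [8 * N], beats the sum [2 * N] of the
    others, so [F], the polynomial without its constant term, increases with
    slope at least [6 * N]. By the hypothesis on [y - x], the values of [- F]
    sweep an interval of length at least 4, which contains an integer congruent
    to 2 modulo 4; taken as constant coefficient, it creates a root between [x]
    and [y]. As it lies between [- F y] and [- F x], the bound on [F] over
    [-1/2, 1/2] controls its contribution to the height. *)
Lemma dominant_linear_coef_root (R : realType) (m N : nat) (d : nat -> nat)
    (x y : R) :
  d m = 1%N -> (forall i, (i < m)%N -> ~~ odd (d i)) ->
  (8 * N <= d 0 <= 10 * N)%N ->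
  (\sum_(i < m) d i.+1 <= 2 * N)%N ->
  - (1 / 2) <= x -> x <= y -> y <= 1 / 2 -> 4 <= 6 * N%:R * (y - x) ->
  exists (a : int) (t : R), [/\ x <= t <= y,
    is_integral_minpoly (poly_cons_coef m a d) t &
    (poly_height (poly_cons_coef m a d) <= 16 * N)%N].
Proof.
move=> d_lead d_even /andP[d0l d0u] dsum hx hxy hy slope.
pose F (t : R) := \sum_(i < m.+1) (d i)%:R * t ^+ i.+1.
have nx : `|x| <= 1 / 2 by rewrite ler_norml; apply/andP; split; lra.
have ny : `|y| <= 1 / 2 by rewrite ler_norml; apply/andP; split; lra.
have n0 : `|0 : R| <= 1 / 2 by rewrite normr0; lra.
have d0lR : 8 * N%:R <= (d 0)%:R :> R by rewrite -natrM ler_nat.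
have d0uR : (d 0)%:R <= 10 * N%:R :> R by rewrite -natrM ler_nat.
have dsumR : \sum_(i < m) `|(d i.+1)%:R| <= 2 * N%:R :> R.
  under eq_bigr => i _ do rewrite normr_nat.
  by rewrite -natr_sum -natrM ler_nat.
have incr (s t : R) : `|s| <= 1 / 2 -> `|t| <= 1 / 2 ->
    `|F t - F s - (d 0)%:R * (t - s)| <= 2 * N%:R * `|t - s|.
  move=> hs ht.
  have := horner_increment_near_linear R m (fun i => (d i)%:R) s t hs ht.
  by move=> /le_trans; apply; rewrite ler_wpM2r.
have F0 : F 0 = 0 by rewrite /F big1 // => i _; rewrite expr0n mulr0.
have Fbound (t : R) : `|t| <= 1 / 2 -> `|F t| <= 6 * N%:R.
  move=> ht; have := incr 0 t n0 ht; rewrite F0 !subr0 => h.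
  have -> : F t = (F t - (d 0)%:R * t) + (d 0)%:R * t by ring.
  (* slopes at most 10 N + 2 N, over a distance at most 1 / 2 *)
  rewrite (le_trans (ler_normD _ _))// normrM normr_nat.
  have := @ler_wpM2r R `|t| (normr_ge0 t) _ _ d0uR.
  have : N%:R * `|t| <= N%:R * (1 / 2) by rewrite ler_wpM2l.
  by nra.
have Fxy : F x + 4 <= F y.
  have := incr x y nx ny; rewrite [`|y - x|]ger0_norm ?subr_ge0//.
  rewrite ler_norml => /andP[+ _].
  have := @ler_wpM2r R (y - x) _ _ _ d0lR; rewrite subr_ge0 => /(_ hxy).
  by lra.
have [|k /andP[k1 k2]] := @exists_2mod4 R (- F y) (- F x); first by lra.
set a := 4 * k + 2 in k1 k2.
exists a.
have [t txy rt] : exists2 t : R, x <= t <= y &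
    root (map_poly intr (poly_cons_coef m a d)) t.
  apply: poly_ivt => //; rewrite !horner_poly_cons_coef // -/(F x) -/(F y).
  by apply/andP; split; lra.
exists t; split=> //.
  split=> //; first exact: poly_cons_coef_monic.
  exact: (poly_cons_coef_irreducible m a d k d_lead).
apply: poly_height_poly_cons_coef => //.
  have : `|a%:~R| <= 6 * N%:R :> R.
    move: (Fbound x nx) (Fbound y ny); rewrite !ler_norml.
    by move=> /andP[? ?] /andP[? ?]; apply/andP; split; lra.
  rewrite -intr_norm -natr_absz -natrM ler_nat => aN.
  by apply: leq_trans aN _; rewrite leq_mul2r orbT.
case=> [|i] hi; first by apply: leq_trans d0u _; rewrite leq_mul2r orbT.
by move: dsum; rewrite (bigD1 (Ordinal hi)) //=; clear; lia.
Qed.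

(** The coefficients of degrees 1, ..., m + 1, as [poly_cons_coef] expects
    them: evenness comes from doubling the entries, the offset [8 * N] makes the
    linear coefficient dominant, and at index [m], the length of [b], the
    default value 1 of [nth] makes the polynomial monic. *)
Definition tuple_coef (m N M : nat) (b : m.-tuple 'I_M) (i : nat) : nat :=
  ((i == 0) * (8 * N) + nth 1 [seq 2 * val j | j <- b] i)%N.

Lemma tuple_coef_lead (m N M : nat) (b : m.-tuple 'I_M) :
  (0 < m)%N -> tuple_coef m N M b m = 1%N.
Proof.
rewrite /tuple_coef => m0; rewrite nth_default ?size_map ?size_tuple//.
by case: m m0 b.
Qed.

Lemma tuple_coef_lt (m N M : nat) (b : m.-tuple 'I_M) (i : 'I_m) :
  tuple_coef m N M b i = ((i == 0 :> nat) * (8 * N) + 2 * tnth b i)%N.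
Proof.
by rewrite /tuple_coef (nth_map (tnth b i)) ?size_tuple// -tnth_nth.
Qed.

(** One root for each tuple of free coefficients. The tuple is recovered from
    the root, since the root determines its minimal polynomial. *)
Lemma many_roots (R : realType) (m M : nat) (x y : R) :
  (0 < m)%N -> (0 < M)%N ->
  - (1 / 2) <= x -> x <= y -> y <= 1 / 2 ->
  4 <= 6 * (m.+1 * M)%:R * (y - x) ->
  exists s : seq R, [/\ uniq s, size s = (M ^ m)%N &
    forall t, t \in s -> x <= t <= y /\
      algint_degree_height_le m.+1 (16 * (m.+1 * M))%N t].
Proof.
move=> m0 M0 hx hxy hy slope; set N := (m.+1 * M)%N in slope *.
have roots (b : m.-tuple 'I_M) : exists at_ : int * R, [/\ x <= at_.2 <= y,
    is_integral_minpoly (poly_cons_coef m at_.1 (tuple_coef m N M b)) at_.2 &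
    (poly_height (poly_cons_coef m at_.1 (tuple_coef m N M b)) <= 16 * N)%N].
  have small (i : nat) : (i < m)%N ->
      (tuple_coef m N M b i <= (i == 0) * (8 * N) + 2 * M)%N.
    move=> hi; have := tuple_coef_lt m N M b (Ordinal hi) => /= ->.
    by have := ltn_ord (tnth b (Ordinal hi)); lia.
  have [|||||||| a [t ht]] :=
    @dominant_linear_coef_root R m N (tuple_coef m N M b) x y => //.
  - exact: tuple_coef_lead.
  - move=> i hi; have := tuple_coef_lt m N M b (Ordinal hi) => /= ->; lia.
  - have := small 0%N m0; have := tuple_coef_lt m N M b (Ordinal m0) => /=.
    rewrite /N; nia.
  - have : (\sum_(i < m) tuple_coef m N M b i.+1 <= \sum_(i < m) (2 * M))%N.
      apply: leq_sum => i _; have := ltn_ord i.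
      rewrite leq_eqVlt => /orP[/eqP ->|/small].
        by rewrite tuple_coef_lead//; lia.
      by rewrite mul0n.
    by rewrite sum_nat_const card_ord /N; nia.
  by exists (a, t).
have [f fP] := choice roots.
exists [seq (f b).2 | b <- enum {: m.-tuple 'I_M}]; split.
- rewrite map_inj_uniq ?enum_uniq // => b b' e.
  have [_ Pb _] := fP b; have [_ Pb' _] := fP b'; rewrite -e in Pb'.
  have E := is_integral_minpoly_inj _ _ _ _ Pb Pb'.
  apply: eq_from_tnth => i; apply: val_inj.
  have := congr1 (fun P : {poly int} => P`_i.+1) E.
  rewrite !coef_poly ltnS (ltnW _) ?ltnS ?(ltnW (ltn_ord i))// => -[].
  by rewrite !tuple_coef_lt => /addnI /eqP; rewrite eqn_pmul2l// => /eqP.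
- by rewrite size_map -cardE card_tuple card_ord.
move=> t /mapP[b _ ->]; have [h1 h2 h3] := fP b; split=> //.
exists (poly_cons_coef m (f b).1 (tuple_coef m N M b)); split => //.
by rewrite size_poly_cons_coef// tuple_coef_lead.
Qed.

Theorem theorem1p2 (R : realType) (n : nat) (hn : (2 <= n)%N) :
  exists c0 : R, 0 < c0 /\
    forall c3 : R, c0 <= c3 ->
      exists c4 Q0 : R, [/\ 0 < c4, 0 < Q0 &
        forall Q : int, Q0 < Q%:~R ->
        forall I : interval R,
          [set` I] `<=` `[- (1 / 2), 1 / 2] ->
          lebesgue_measure [set` I] = (c3 * Q%:~R^-1)%:E ->
          exists s : seq R,
            [/\ uniq s,
                forall a : R, a \in s ->
                  a \in I /\ algint_degree_height_le n Q a &
                ((c4 * Q%:~R ^+ n)%:E * lebesgue_measure [set` I]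
                   <= (size s)%:R%:E)%E]].
Proof.
(* 64 makes the slope 6 (m + 1) M >= 6 q / 32 times the length c3 / (2 q)
   exceed 4 *)
case: n hn => [//|m] m0; rewrite ltnS in m0.
pose w : R := (32 * m.+1)%:R.
have w0 : 0 < w by rewrite ltr0n.
exists 64; split=> // c3 hc3; have c30 : 0 < c3 by lra.
exists (c3^-1 / w ^+ m), (16 * m.+1)%:R; split; first 2 last.
- case=> q; last first.
    have Qneg : (Negz q)%:~R < 0 :> R by rewrite ltrz0.
    by move=> /lt_trans/(_ Qneg); rewrite ltrn0.
  rewrite -(pmulrn 1 q) ltr_nat => qbig I Isub Imeas.
  (* the height bound 16 (m + 1) M is made to fit below q *)
  pose M := (q %/ (16 * m.+1))%N.
  have M0 : (0 < M)%N by rewrite divn_gt0// ltnW.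
  have Mle : (16 * (m.+1 * M) <= q)%N by rewrite mulnA mulnC leq_divM.
  have qle : (q <= 32 * m.+1 * M)%N.
    by have := @ltn_ceil q (16 * m.+1) isT; rewrite -/M; nia.
  have q0 : 0 < q%:R :> R by rewrite ltr0n (leq_ltn_trans _ qbig).
  have qleR : q%:R <= w * M%:R :> R by rewrite /w -natrM ler_nat.
  have [x [y [yx xyI]]] :=
    itv_contains_middle_half _ _ _ (divr_gt0 c30 q0) Imeas.
  have xy : x <= y.
    by rewrite -subr_ge0 yx !divr_ge0// ltW.
  have half t : t \in I -> - (1 / 2) <= t <= 1 / 2.
    by move=> tI; have := Isub t tI; rewrite /= in_itv.
  have /half/andP[hx _] : x \in I by apply: xyI; rewrite lexx.
  have /half/andP[_ hy] : y \in I by apply: xyI; rewrite lexx andbT.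
  have slope : 4 <= 6 * (m.+1 * M)%:R * (y - x).
    (* c3 / 2 = q (y - x), and (m + 1) M is at least q / 32 *)
    have : 2^-1 * c3 <= w * M%:R * (y - x).
      rewrite yx; apply: le_trans (ler_wpM2r _ qleR); last first.
        by rewrite !divr_ge0// ltW.
      by rewrite le_eqVlt; apply/orP; left; apply/eqP; field; lra.
    by rewrite /w !natrM; lra.
  have [s [us ss sP]] := many_roots R m M x y m0 M0 hx xy hy slope.
  exists s; split=> // [t ts|].
    have [txy [P [Pmin Psize Pheight]]] := sP t ts; split; first exact: xyI.
    exists P; split=> //; apply: le_trans Pheight _.
    by rewrite lez_nat.
  rewrite Imeas -EFinM lee_fin ss natrX.
  have -> : c3^-1 / w ^+ m * q%:R ^+ m.+1 * (c3 / q%:R) = (q%:R / w) ^+ m.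
    rewrite exprS expr_div_n; field.
    by rewrite !lt0r_neq0 ?exprn_gt0.
  by rewrite lerXn2r ?nnegrE ?divr_ge0 ?ler0n// ler_pdivrMr// mulrC.
- by rewrite divr_gt0 ?invr_gt0 ?exprn_gt0.
- by rewrite ltr0n.
Qed.
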